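(* Let $X_t=e^{Y_t}$ be an exponential Lévy process with characteristic exponent $\phi$, let $f(x)=x^\beta$ and $g(X_t,t)=e^{-ct}f(X_t)$ with $c>0$, and assume $\phi_1(\beta)<0$ and $\phi_2(2\beta)<0$, where $\phi_1(\cdot)=\phi(\cdot)-c$ and $\phi_2(\cdot)=\phi(\cdot)-2c$. Let $m>0$ and consider $$\inf_{Q\in\mathcal{M}(\mathbb{R}^+):\ \mathbb{E}^Q[N]=m}\operatorname{Var}\left(\int_0^\infty g(X_s,s)\frac{1_{\{N>s\}}}{Q(N>s)}\,ds\right).$$ When $m|\phi_2(2\beta)|\le2$, the infimum is attained at the distribution $Q^*$ given by $$Q^*(N>s)=\frac m2|\phi_2(2\beta)|\,e^{-\frac s2|\phi_2(2\beta)|}\qquad\text{for any }0<s<\infty.$$ When $m|\phi_2(2\beta)|>2$, the infimum is attained at the distribution $Q^*$ given by $$Q^*(N>s)=\begin{cases}1 & \text{for } s\le m-\frac{2}{|\phi_2(2\beta)|},\\ e^{\frac m2|\phi_2(2\beta)|-1-\frac s2|\phi_2(2\beta)|} & \text{for } s>m-\frac{2}{|\phi_2(2\beta)|}.\end{cases}$$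
   Context: $Y=\{Y_t:t\ge0\}$ is a real-valued Lévy process with $Y_0=0$, and $\phi$ denotes its (real) exponent, $\mathbb{E}[e^{bY_t}]=e^{t\phi(b)}$, assumed finite for $b\in\{\beta,2\beta\}$, where $\beta\in\mathbb{R}$ is fixed. $\mathcal{M}(\mathbb{R}^+)$ denotes the set of probability distributions $Q$ of a random variable $N$, independent of $X$, with $Q(N\ge0)=1$ and $Q(N>s)>0$ for all $s\in[0,\infty)$; $\mathbb{E}^Q[N]$ is the mean of $N$ under $Q$. The variance is $+\infty$ when the estimator is not square-integrable. *)

(* Defs.v *)
From HB Require Import structures.
From mathcomp Require Export all_boot all_order all_algebra.
From mathcomp Require Export all_classical all_reals all_analysis.
Set Implicit Arguments.
Unset Strict Implicit.
Unset Printing Implicit Defensive.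
Export Order.TTheory GRing.Theory Num.Theory.
Export numFieldNormedType.Exports.
Local Open Scope classical_set_scope.
Local Open Scope ring_scope.

(* Processes are indexed by R; only the times t >= 0 are ever used. *)

Definition cadlag (R : realType) (y : R -> R) : Prop :=
  (forall t, 0 <= t -> y s @[s --> t^'+] --> y t) /\
  (forall t, 0 < t -> cvg (y s @[s --> t^'-])).

Definition increment d (T : measurableType d) (R : realType)
    (P : probability T R) (Y : R -> {RV P >-> R}) (s t : R) (w : T) : R :=
  Y t w - Y s w.

(* Mutual independence of the increments: since some of the sets A i may be
   setT, the product rule for the whole family contains the product rule for
   every subfamily. *)
Definition independent_increments d (T : measurableType d) (R : realType)
    (P : probability T R) (Y : R -> {RV P >-> R}) : Prop :=
  forall (n : nat) (t : nat -> R) (A : nat -> set R),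
    0 <= t 0%N -> (forall i, t i <= t i.+1) -> (forall i, measurable (A i)) ->
    P (\bigcap_(i in `I_n) (increment Y (t i) (t i.+1) @^-1` A i)) =
    (\prod_(i < n) P (increment Y (t i) (t i.+1) @^-1` A i))%E.

Definition stationary_increments d (T : measurableType d) (R : realType)
    (P : probability T R) (Y : R -> {RV P >-> R}) : Prop :=
  forall (s h : R) (A : set R), 0 <= s -> 0 <= h -> measurable A ->
    P (increment Y s (s + h) @^-1` A) = P (Y h @^-1` A).

Definition levy_process d (T : measurableType d) (R : realType)
    (P : probability T R) (Y : R -> {RV P >-> R}) : Prop :=
  [/\ {ae P, forall w, Y 0 w = 0},
      {ae P, forall w, cadlag (fun t => Y t w)},
      independent_increments Y
    & stationary_increments Y].

(* The real number phi b satisfies E[exp(b Y_t)] = exp(t phi(b)) for all t >= 0;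
   in particular these exponential moments are finite. *)
Definition has_exponent_at d (T : measurableType d) (R : realType)
    (P : probability T R) (Y : R -> {RV P >-> R}) (phi : R -> R) (b : R) : Prop :=
  forall t, 0 <= t ->
    ('E_P[fun w => expR (b * Y t w)] = (expR (t * phi b))%:E)%E.

Definition exp_process d (T : measurableType d) (R : realType)
    (P : probability T R) (Y : R -> {RV P >-> R}) (t : R) (w : T) : R :=
  expR (Y t w).

(* Q(N > s), for N with distribution Q *)
Definition survival (R : realType) (Q : probability R R) (s : R) : R :=
  fine (Q [set n : R | s < n]).

Definition randomization_laws (R : realType) : set (probability R R) :=
  [set Q : probability R R | Q [set n : R | 0 <= n] = 1%E /\
                             (forall s, 0 <= s -> 0 < survival Q s)].

Definition mean (R : realType) (Q : probability R R) : \bar R :=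
  'E_Q[fun n => n]%E.

Definition estimator_integrand (T : Type) (R : realType)
    (X : R -> T -> R) (g : R -> R -> R) (Q : probability R R) (N : T -> R)
    (w : T) (s : R) : R :=
  g (X s w) s * ((s < N w)%R%:R / survival Q s).

Definition estimator (T : Type) (R : realType)
    (X : R -> T -> R) (g : R -> R -> R) (Q : probability R R) (N : T -> R)
    (w : T) : \bar R :=
  (\int[lebesgue_measure]_(s in `[0%R, +oo[)
     (estimator_integrand X g Q N w s)%:E)%E.

(* Variance of an extended-real random variable: +oo when it is not
   square-integrable; otherwise it is almost surely finite. *)
Definition evariance d (T : measurableType d) (R : realType)
    (P : probability T R) (Z : T -> \bar R) : \bar R :=
  (if \int[P]_w (Z w ^+ 2) < +oo then 'V_P[fun w => fine (Z w)] else +oo)%E.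

(* The process X and an independent N with distribution Q are realized as the
   two coordinates of the product T * R under the product measure P \x Q: the
   first coordinate has distribution P, the second has distribution Q, and the
   two are independent. *)
Definition estimator_variance d (T : measurableType d) (R : realType)
    (P : probability T R) (X : R -> T -> R) (g : R -> R -> R)
    (Q : probability R R) : \bar R :=
  evariance (P \x Q)%E
    (estimator (fun s (w : T * R) => X s w.1) g Q (fun w : T * R => w.2)).

Definition admissible (R : realType) (m : R) : set (probability R R) :=
  [set Q : probability R R | randomization_laws Q /\ mean Q = m%:E].

Definition infimum_attained_at d (T : measurableType d) (R : realType)
    (P : probability T R) (X : R -> T -> R) (g : R -> R -> R) (m : R)
    (Q : probability R R) : Prop :=
  admissible m Q /\
  ereal_inf [set estimator_variance P X g Q' | Q' in admissible m] =
    estimator_variance P X g Q.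

(* Main.v *)
Require Import Defs.
From HB Require Import structures.
From mathcomp Require Import ring lra measurable_realfun.
Set Implicit Arguments.
Unset Strict Implicit.
Unset Printing Implicit Defensive.
Local Open Scope classical_set_scope.
Local Open Scope ring_scope.

(* Write h_s = exp(-cs + beta Y_s), S(s) = Q(N > s), a = |phi2(2 beta)| and
   theta = |phi1(beta)|. For s <= t the independent stationary increments give
   E[h_s h_t] = exp(-as) exp(-theta (t - s)), and
   E[1_{N>s} 1_{N>t}] / (S(s) S(t)) = 1 / S(s), so by Tonelli the estimator has
   second moment (2 / theta) * int_0^oo exp(-as) / S(s) ds, while its mean does
   not depend on Q. As E[N] = int_0^oo S = m, it remains to minimize
   int exp(-as) / S(s) ds over survival functions of given integral. With the
   multiplier k = exp(-a s0), the integrand exp(-as) / S + k S is minimized over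
   S in ]0, 1] by min(1, exp(-(a/2) (s - s0))), the survival function of
   max(0, s0 + E) with E exponential of rate a/2; the constraint fixes s0, which
   is nonpositive exactly when m a <= 2. *)

(** * Changing nonnegative integrands on a null set *)

Section ae_integral.
Local Open Scope ereal_scope.
Context d (T : measurableType d) (R : realType).
Variable mu : {measure set T -> \bar R}.
Import HBNNSimple.

(* The integrands need not be measurable: Y is only almost surely cadlag, so the
   estimator itself may fail to be measurable on a null set. *)
Lemma le_integral_off_null (N : set T) (f g : T -> \bar R) :
  measurable N -> mu N = 0 -> (forall x, 0 <= f x) -> (forall x, 0 <= g x) ->
  (forall x, ~ N x -> f x = g x) -> \int[mu]_x f x <= \int[mu]_x g x.
Proof.
move=> mN N0 f0 g0 fg; rewrite !ge0_integralTE//.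
apply: ge_ereal_sup => _ [h /= hf <-].
have mNC : measurable (~` N) by exact: measurableC.
(* The integral is a supremum over simple functions. Cutting [h] to 0 on [N] keeps its integral and
   puts it below [g] everywhere. *)
apply: ereal_sup_ubound; exists (proj_nnsfun h mNC) => [x|].
  have -> : proj_nnsfun h mNC x = (h \_ (~` N)) x by rewrite (mrestrict h mNC).
  rewrite patchE.
  by case: ifPn => // /set_mem nN; rewrite -fg.
rewrite -!integralT_nnsfun [RHS](ge0_negligible_integral mN)//; last 2 first.
- exact/measurable_EFinP.
- by move=> x _; rewrite lee_fin.
rewrite setTD [RHS]integral_mkcond; apply: eq_integral => x _.
have -> : proj_nnsfun h mNC x = (h \_ (~` N)) x by rewrite (mrestrict h mNC).
by rewrite !patchE; case: ifP.
Qed.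

Lemma eq_integral_off_null (N : set T) (f g : T -> \bar R) :
  measurable N -> mu N = 0 -> (forall x, 0 <= f x) -> (forall x, 0 <= g x) ->
  (forall x, ~ N x -> f x = g x) -> \int[mu]_x f x = \int[mu]_x g x.
Proof.
move=> mN N0 f0 g0 fg; apply/eqP; rewrite eq_le.
by rewrite !(@le_integral_off_null N)// => x /fg.
Qed.

End ae_integral.

(** * Joint measurability of right-continuous processes *)

Section joint_measurability.
Context d (T : measurableType d) (R : realType).

(** Floor plus one, rather than a ceiling, keeps the grid point strictly to the right of [s] even
    when [s] lies on the grid, as sequences for a right limit require. *)
Definition above_floor (n : nat) (s : R) : R :=
  (Num.floor (s * n.+1%:R) + 1)%:~R / n.+1%:R.

Lemma above_floor_gt n (s : R) : s < above_floor n s.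
Proof.
rewrite /above_floor ltr_pdivlMr ?ltr0n//; exact: floorD1_gt.
Qed.

Lemma above_floor_cvg (s : R) : above_floor ^~ s @ \oo --> s.
Proof.
apply: (@squeeze_cvgr _ _ _ _ (fun=> s) (fun n => s + n.+1%:R^-1)); last 2 first.
- exact: cvg_cst.
- rewrite -[X in _ --> X]addr0.
  by apply: cvgD; [exact: cvg_cst|exact: cvg_harmonic].
near=> n; rewrite ltW ?above_floor_gt//=.
rewrite /above_floor ler_pdivrMr ?ltr0n// mulrDl mulVf ?pnatr_eq0//.
by rewrite intrD lerD2r floor_le.
Unshelve. all: by end_near. Qed.

(* u(s, w) is the limit of u(s_n, w), with s_n > s the next point of a grid. *)
Lemma measurable_right_continuous_process (u : R -> T -> R) :
  (forall t, measurable_fun setT (u t)) ->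
  (forall w, right_continuous (u ^~ w)) ->
  measurable_fun setT (fun p : R * T => u p.1 p.2).
Proof.
move=> mu rcu.
apply: (@measurable_fun_cvg _ _ _ _ (fun n (p : R * T) => u (above_floor n p.1) p.2)).
  move=> n _ Y mY; rewrite setTI.
  (* On the strip [E k] the grid point is constant, so the preimage is a countable union of
     measurable rectangles. *)
  pose E (k : int) := [set p : R * T | Num.floor (p.1 * n.+1%:R) = k].
  have -> : (fun p : R * T => u (above_floor n p.1) p.2) @^-1` Y =
    \bigcup_(k in [set: int]) ((E k) `&` (u ((k + 1)%:~R / n.+1%:R) \o snd) @^-1` Y).
    apply/seteqP; split=> p /=.
      by move=> up; exists (Num.floor (p.1 * n.+1%:R)).
    by move=> [k _ [/= <-]].
  apply: countable_bigcupT_measurable => [|k]; first exact: countableP.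
  apply: measurableI.
    rewrite (_ : E k = fst @^-1` `[k%:~R / n.+1%:R, (k + 1)%:~R / n.+1%:R[).
      rewrite -[X in measurable X]setTI; exact: measurable_fst.
    apply/seteqP; split => p; rewrite /E /= in_itv/= ler_pdivrMr// ltr_pdivlMr//.
      by move/eqP; rewrite floor_eq.
    by move=> h; apply/eqP; rewrite floor_eq.
  rewrite -[X in measurable X]setTI.
  by apply: (measurableT_comp (mu _) measurable_snd).
move=> p _.
have /cvg_at_rightP := rcu p.2 p.1; apply; split.
  by move=> n; exact: above_floor_gt.
exact: above_floor_cvg.
Qed.

End joint_measurability.

(** * Product integrals and independence *)

Section product_integral.
Local Open Scope ereal_scope.
Context d1 d2 (T1 : measurableType d1) (T2 : measurableType d2) (R : realType).
Variables (m1 : {sigma_finite_measure set T1 -> \bar R}).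
Variables (m2 : {sigma_finite_measure set T2 -> \bar R}).

Lemma ge0_integral_product (f : T1 -> R) (g : T2 -> R) :
  measurable_fun setT f -> measurable_fun setT g ->
  (forall x, 0 <= f x)%R -> (forall y, 0 <= g y)%R ->
  \int[m1 \x m2]_p (f p.1 * g p.2)%:E =
  (\int[m1]_x (f x)%:E) * (\int[m2]_y (g y)%:E).
Proof.
move=> mf mg f0 g0; rewrite fubini_tonelli1; first last.
- by move=> p; rewrite lee_fin mulr_ge0.
- apply/measurable_EFinP; apply: measurable_funM.
    exact: measurableT_comp mf measurable_fst.
  exact: measurableT_comp mg measurable_snd.
rewrite -ge0_integralZr//; last 3 first.
- exact/measurable_EFinP.
- by move=> x _; rewrite lee_fin.
- by apply: integral_ge0 => y _; rewrite lee_fin.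
apply: eq_integral => x _; rewrite /fubini_F /=.
under eq_integral do rewrite EFinM.
rewrite ge0_integralZl ?lee_fin//; first exact/measurable_EFinP.
by move=> y _; rewrite lee_fin.
Qed.

End product_integral.

Section independence.
Local Open Scope ereal_scope.
Context d (T : measurableType d) (R : realType) (P : probability T R).

(** The joint law of [(U, V)] agrees with the product of the marginals on rectangles, hence equals
    it by uniqueness of product measures; Tonelli then separates the factors. *)
Lemma ge0_integral_independent (U V : {RV P >-> R}) (f g : R -> R) :
  (forall A B, measurable A -> measurable B ->
    P (U @^-1` A `&` V @^-1` B) = P (U @^-1` A) * P (V @^-1` B)) ->
  measurable_fun setT f -> measurable_fun setT g ->
  (forall x, 0 <= f x)%R -> (forall y, 0 <= g y)%R ->
  \int[P]_w (f (U w) * g (V w))%:E =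
  (\int[P]_w (f (U w))%:E) * (\int[P]_w (g (V w))%:E).
Proof.
move=> UV mf mg f0 g0.
have mUV : measurable_fun setT (fun w => (U w, V w)).
  by apply: measurable_fun_pair.
pose fg (p : R * R) := (f p.1 * g p.2)%:E.
have mfg : measurable_fun setT fg.
  apply/measurable_EFinP; apply: measurable_funM.
    exact: measurableT_comp mf measurable_fst.
  exact: measurableT_comp mg measurable_snd.
transitivity (\int[pushforward P (fun w => (U w, V w))]_p fg p).
  rewrite ge0_integral_pushforward//.
  by move=> p _; rewrite lee_fin mulr_ge0.
transitivity (\int[distribution P U \x distribution P V]_p fg p).
  apply/esym/eq_measure_integral => A mA _.
  apply: product_measure_unique => // B C mB mC.
rewrite ge0_integral_product//.
rewrite -[X in _ = X * _](ge0_integral_distribution U (f := EFin \o f))//.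
- rewrite -[X in _ = _ * X](ge0_integral_distribution V (f := EFin \o g))//.
  exact/measurable_EFinP.
- exact/measurable_EFinP.
Qed.

Lemma ge0_integral_eq_distribution (U V : {RV P >-> R}) (f : R -> R) :
  (forall A, measurable A -> P (U @^-1` A) = P (V @^-1` A)) ->
  measurable_fun setT f -> (forall x, 0 <= f x)%R ->
  \int[P]_w (f (U w))%:E = \int[P]_w (f (V w))%:E.
Proof.
move=> UV mf f0.
have mEf : measurable_fun setT (EFin \o f) by exact/measurable_EFinP.
rewrite -[LHS](ge0_integral_distribution U (f := EFin \o f))//.
rewrite -[RHS](ge0_integral_distribution V (f := EFin \o f))//.
by apply: eq_measure_integral => A mA _; exact: UV.
Qed.

End independence.

(** * Two-time exponential moments of the Lévy process *)

Section levy_moment.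
Local Open Scope ereal_scope.
Context d (T : measurableType d) (R : realType) (P : probability T R).
Variable Y : R -> {RV P >-> R}.

Lemma measurable_increment s t : measurable_fun setT (increment Y s t).
Proof. by apply: measurable_funB. Qed.

Let inc s t : {RV P >-> R} := HB.pack (increment Y s t)
  (isMeasurableFun.Build _ _ _ _ _ (measurable_increment s t)).

Lemma levy_increments_independent (s t : R) (A B : set R) :
  independent_increments Y -> (0 <= s)%R -> (s <= t)%R ->
  measurable A -> measurable B ->
  P (increment Y 0 s @^-1` A `&` increment Y s t @^-1` B) =
  P (increment Y 0 s @^-1` A) * P (increment Y s t @^-1` B).
Proof.
move=> hI s0 st mA mB.
(* Partition [0, s, t, t, ...]: continuing it constantly keeps it nondecreasing, and only its first
   two increments enter. *)
have := hI 2%N (fun i => if i is i'.+1 then if i' is _.+1 then t else s else 0%R)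
  (fun i => if i is _.+1 then B else A).
rewrite bigcap_mkord !big_ord_recl !big_ord0 /= mule1 setIT; apply => //.
  by move=> [|[|i]].
by case.
Qed.

Variables (phi : R -> R) (b : R).
Hypothesis hY : levy_process Y.
Hypothesis hphi1 : has_exponent_at Y phi b.
Hypothesis hphi2 : has_exponent_at Y phi (2 * b).

Let measurable_expM (r : R) : measurable_fun setT (fun x : R => expR (r * x)).
Proof.
by apply: measurableT_comp => //; apply: measurable_funM.
Qed.

(** Since [b Y_s + b Y_t = 2 b Y_s + b (Y_t - Y_s)], independence splits the expectation, and
    stationarity gives the second factor the law of [Y (t - s)]. *)
Lemma levy_exp_moment2 (s t : R) : (0 <= s)%R -> (s <= t)%R ->
  \int[P]_w (expR (b * Y s w) * expR (b * Y t w))%:E =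
  (expR (s * phi (2 * b)) * expR ((t - s) * phi b))%:E.
Proof.
move=> s0 st; have [[N [mN N0 hN]] _ hI hS] := hY.
pose f x := expR (2 * b * x); pose g x := expR (b * x).
(* Independence is available for increments only, so [Y s] is replaced by [Y s - Y 0], equal to it
   off the null set where [Y 0] is nonzero. *)
transitivity (\int[P]_w (f (inc 0 s w) * g (inc s t w))%:E).
  apply: (eq_integral_off_null mN N0).
  - by move=> w; rewrite lee_fin mulr_ge0// expR_ge0.
  - by move=> w; rewrite lee_fin mulr_ge0// expR_ge0.
  move=> w nNw; rewrite /f /g /= /increment -!expRD.
  have -> : Y 0 w = 0%R by apply: contrapT => h; apply: nNw; exact: hN.
  by congr (expR _)%:E; ring.
rewrite ge0_integral_independent; last 5 first.
- by move=> A B mA mB; exact: levy_increments_independent.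
- exact: measurable_expM.
- exact: measurable_expM.
- by move=> x; exact: expR_ge0.
- by move=> x; exact: expR_ge0.
rewrite EFinM; congr (_ * _).
  have := hphi2 s0; rewrite unlock => <-.
  apply: (eq_integral_off_null mN N0).
  - by move=> w; rewrite lee_fin expR_ge0.
  - by move=> w; rewrite lee_fin expR_ge0.
  move=> w nNw; rewrite /f /= /increment.
  have -> : Y 0 w = 0%R by apply: contrapT => h; apply: nNw; exact: hN.
  by rewrite subr0.
have ts0 : (0 <= t - s)%R by rewrite subr_ge0.
have := hphi1 ts0; rewrite unlock => <-.
apply: (@ge0_integral_eq_distribution _ _ _ _ (inc s t) (Y (t - s)) g).
- by move=> A mA /=; rewrite -(hS s)// addrCA subrr addr0.
- exact: measurable_expM.
- by move=> x; exact: expR_ge0.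
Qed.

End levy_moment.

(** * Integral of a decaying exponential over a half-line *)

Section exponential_tail.
Context (R : realType).

Lemma integral_expR_tail (r s : R) : 0 < r ->
  (\int[lebesgue_measure]_(t in `[s, +oo[) (expR (- r * (t - s)))%:E = (r^-1)%:E)%E.
Proof.
move=> r0.
have cf : continuous (fun t : R => expR (- r * (t - s))).
  move=> t; apply: continuous_comp; last exact: continuous_expR.
  by apply: cvgM; [exact: cvg_cst|apply: cvgB; [exact: cvg_id|exact: cvg_cst]].
have dF (x : R) : is_derive x 1%R (fun t => - (r^-1 * expR (- r * (t - s))))%R
    (expR (- r * (x - s))).
  have h : is_derive x 1%R (fun t : R => - r * (t - s))%R (- r).
    apply: is_derive_eq.
    by rewrite subr0 -[RHS]mulr1.
  have k := @is_derive1_comp _ expR (fun t : R => - r * (t - s)) x _ _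
    (is_derive_expR _) h.
  apply: (@is_derive_eq _ _ _ _ _ _ _ _ (is_deriveN (is_deriveZ r^-1 k))).
  by rewrite /GRing.scale /=; field; rewrite gt_eqF.
rewrite (@ge0_continuous_FTC2y _ _ (fun t => - (r^-1 * expR (- r * (t - s))))%R _ 0%R)//.
- by rewrite subrr mulr0 expR0 mulr1 EFinN oppeK add0e.
- exact: continuous_subspaceT.
- rewrite -oppr0; apply: cvgN; rewrite -(mulr0 r^-1); apply: cvgMr.
  rewrite (_ : (fun x => expR (- r * (x - s))) =
      (fun x => expR (r * s) * ((fun z => expR (- z)) \o (fun z => r * z)) x)).
    rewrite -(mulr0 (expR (r * s))); apply: cvgMr.
    apply: (@cvg_comp _ _ _ _ _ _ (pinfty_nbhs R)); last exact: cvgr_expR.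
    exact: gt0_cvgMry.
  by apply: eq_fun => x /=; rewrite -expRD; congr expR; ring.
- by apply: cvgN; apply: cvgMr; apply: cvg_at_right_filter; exact: cf.
- by move=> x _; rewrite derive1E derive_val.
Qed.

End exponential_tail.

(** * Elementary properties of survival functions *)

Section survival_function.
Context (R : realType) (Q : probability R R).

Lemma measurable_gt (s : R) : measurable [set n : R | s < n].
Proof. by rewrite -set_itvoy. Qed.

Lemma survivalK s : (survival Q s)%:E = Q [set n | s < n].
Proof. by rewrite fineK// fin_num_measure//; exact: measurable_gt. Qed.

Lemma survival_ge0 s : 0 <= survival Q s.
Proof. exact: fine_ge0. Qed.

Lemma survival_le1 s : survival Q s <= 1.
Proof. by rewrite -lee_fin survivalK probability_le1//; exact: measurable_gt. Qed.

Lemma measurable_survival : measurable_fun setT (survival Q).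
Proof.
have mid : measurable_fun setT (@id R) by exact: measurable_id.
(* [Q] is the law of the identity, whose complementary distribution function is the survival
   function. *)
pose X : {RV Q >-> R} := HB.pack (@id R) (isMeasurableFun.Build _ _ _ _ _ mid).
apply: (measurableT_comp (fine_measurable measurableT)).
rewrite (_ : (fun s => Q [set n | s < n]) = ccdf X); first exact: ccdf_measurable.
by apply/funext => s; rewrite /ccdf set_itvoy.
Qed.

End survival_function.

(** * Folding a symmetric double integral along the diagonal *)

Section symmetric_double_integral.
Local Open Scope ereal_scope.
Context (R : realType).
Local Notation leb := (@lebesgue_measure R).

(** The plane splits into [s <= t] and [t < s]; Tonelli and the symmetry of [G] carry the second
    half onto [s < t], which differs from the first by the null diagonal. *)
Lemma integral_symmetric (G : R * R -> \bar R) :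
  measurable_fun setT G -> (forall p, 0 <= G p) ->
  (forall s t, G (s, t) = G (t, s)) ->
  \int[leb]_s \int[leb]_t G (s, t) =
  2%:E * \int[leb]_s \int[leb]_(t in `[s, +oo[) G (s, t).
Proof.
move=> mG G0 Gsym.
pose G1 (p : R * R) := if (p.1 <= p.2)%R then G p else 0.
pose G2 (p : R * R) := if (p.1 < p.2)%R then G p else 0.
pose G3 (p : R * R) := if (p.2 < p.1)%R then G p else 0.
have m1 : measurable_fun setT (@fst R R) by exact: measurable_fst.
have m2 : measurable_fun setT (@snd R R) by exact: measurable_snd.
have mG1 : measurable_fun setT G1.
  by apply: measurable_fun_ifT => //; exact: measurable_fun_ler.
have mG2 : measurable_fun setT G2.
  by apply: measurable_fun_ifT => //; exact: measurable_fun_ltr.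
have mG3 : measurable_fun setT G3.
  by apply: measurable_fun_ifT => //; exact: measurable_fun_ltr.
have G10 p : 0 <= G1 p by rewrite /G1; case: ifP.
have G20 p : 0 <= G2 p by rewrite /G2; case: ifP.
have G30 p : 0 <= G3 p by rewrite /G3; case: ifP.
have E1 s : \int[leb]_t G1 (s, t) = \int[leb]_(t in `[s, +oo[) G (s, t).
  rewrite [RHS]integral_mkcond; apply: eq_integral => t _.
  by rewrite /G1 patchE mem_setE in_itv/= andbT.
have E2 s : \int[leb]_t G2 (s, t) = \int[leb]_(t in `[s, +oo[) G (s, t).
  (* The endpoint [t = s] is a null set, so the open half-line may be closed. *)
  rewrite -integral_itv_obnd_cbnd; last first.
    by apply: measurable_funTS; exact: measurableT_comp mG (pair1_measurable s).
  rewrite [RHS]integral_mkcond; apply: eq_integral => t _.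
  by rewrite /G2 patchE mem_setE in_itv/= andbT.
transitivity (\int[leb]_s \int[leb]_t G1 (s, t) + \int[leb]_s \int[leb]_t G3 (s, t)).
  rewrite -ge0_integralD//; last 4 first.
  - by move=> s _; apply: integral_ge0 => t _.
  - exact: (@measurable_fun_fubini_tonelli_F _ _ _ _ _ leb G1 mG1 G10).
  - by move=> s _; apply: integral_ge0 => t _.
  - exact: (@measurable_fun_fubini_tonelli_F _ _ _ _ _ leb G3 mG3 G30).
  apply: eq_integral => s _; rewrite -ge0_integralD//; last 2 first.
  - exact: measurableT_comp mG1 (pair1_measurable s).
  - exact: measurableT_comp mG3 (pair1_measurable s).
  apply: eq_integral => t _; rewrite /G1 /G3 /=.
  by case: leP => _; rewrite ?adde0 ?add0e.
have -> : \int[leb]_s \int[leb]_t G3 (s, t) = \int[leb]_t \int[leb]_s G3 (s, t).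
  exact: (@fubini_tonelli _ _ _ _ _ leb leb G3 mG3 G30).
have -> : \int[leb]_s \int[leb]_t G1 (s, t) =
    \int[leb]_s \int[leb]_(t in `[s, +oo[) G (s, t).
  by apply: eq_integral => s _; exact: E1.
rewrite [X in _ + X](_ : _ = \int[leb]_s \int[leb]_(t in `[s, +oo[) G (s, t)).
  by rewrite -mule2n mule_natl.
apply: eq_integral => t _; rewrite -E2; apply: eq_integral => s _.
by rewrite /G2 /G3 /= Gsym.
Qed.

End symmetric_double_integral.

Lemma measurable_gt_natr (R : realType) (s : R) :
  measurable_fun setT (fun n : R => (s < n)%R%:R : R).
Proof.
rewrite (_ : (fun n : R => _) = \1_[set n : R | s < n]).
  by apply: measurable_indic; exact: measurable_gt.
by apply/funext => n; rewrite indicE mem_setE.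
Qed.

(** * First and second moments of the randomized estimator *)

Section estimator_moments.
Context d (T : measurableType d) (R : realType) (P : probability T R).
Context (Q : probability R R) (h : R -> T -> R).
Local Notation leb := (@lebesgue_measure R).
Hypothesis mh : measurable_fun setT (fun p : R * T => h p.1 p.2).
Hypothesis h_ge0 : forall s w, 0 <= h s w.
Hypothesis h_lt0 : forall s w, s < 0 -> h s w = 0.
Hypothesis S_gt0 : forall s, 0 <= s -> 0 < survival Q s.

(** The estimator's integrand with [g (X s) s] replaced by a jointly measurable [h] vanishing at
    negative times, so that all time integrals can run over the whole line. *)
Definition randomized (w : T * R) (s : R) : R :=
  h s w.1 * ((s < w.2)%R%:R / survival Q s).

Let PQ : probability (T * R)%type R := (P \x Q)%E.
Local Notation Z w := (\int[leb]_s (randomized w s)%:E)%E.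

Lemma randomized_ge0 w s : 0 <= randomized w s.
Proof. by rewrite mulr_ge0// divr_ge0// survival_ge0. Qed.

Lemma measurable_stopping_weight :
  measurable_fun setT (fun p : R * R => (p.1 < p.2)%R%:R / survival Q p.1).
Proof.
apply: measurable_funM.
  rewrite (_ : (fun p : R * R => (p.1 < p.2)%R%:R) =
     (fun p : R * R => if p.1 < p.2 then 1 else 0 : R)); last first.
    by apply/funext => p; case: ifP.
  apply: measurable_fun_ifT => //.
  by apply: measurable_fun_ltr; [exact: measurable_fst|exact: measurable_snd].
(* Measurability is read off a real power; it agrees with the inverse also at 0, where both are
   0. *)
rewrite (_ : (fun p : R * R => (survival Q p.1)^-1) =
             (fun p => survival Q p.1 `^ (-1))); last first.
  by apply/funext => p; rewrite powR_inv1// survival_ge0.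
exact: (measurableT_comp (measurable_powR _)
  (measurableT_comp (measurable_survival Q) measurable_fst)).
Qed.

Lemma measurable_randomized :
  measurable_fun setT (fun p : (T * R) * R => randomized p.1 p.2).
Proof.
have m1 : measurable_fun setT (fun p : (T * R) * R => p.1) by exact: measurable_fst.
have m2 : measurable_fun setT (fun p : (T * R) * R => p.2) by exact: measurable_snd.
have m11 : measurable_fun setT (fun p : (T * R) * R => p.1.1).
  exact: measurableT_comp measurable_fst m1.
have m12 : measurable_fun setT (fun p : (T * R) * R => p.1.2).
  exact: measurableT_comp measurable_snd m1.
apply: measurable_funM.
  exact: (measurableT_comp mh (measurable_fun_pair m2 m11)).
exact: (measurableT_comp measurable_stopping_weight (measurable_fun_pair m2 m12)).
Qed.

Let mEr : measurable_fun setT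
  (fun p : (T * R) * R => (randomized p.1 p.2)%:E).
Proof. by apply/measurable_EFinP; exact: measurable_randomized. Qed.

Let Er_ge0 (p : (T * R) * R) : (0 <= (randomized p.1 p.2)%:E)%E.
Proof. by rewrite lee_fin randomized_ge0. Qed.

Lemma measurable_integral_randomized :
  measurable_fun setT (fun w : T * R => Z w).
Proof.
exact: (@measurable_fun_fubini_tonelli_F _ _ _ _ _ leb _ mEr Er_ge0).
Qed.

Let mhs s : measurable_fun setT (h s).
Proof. exact: (measurableT_comp mh (pair1_measurable s)). Qed.

Let mws s : measurable_fun setT (fun n : R => (s < n)%R%:R / survival Q s).
Proof. exact: (measurableT_comp measurable_stopping_weight (pair1_measurable s)). Qed.

Let w_ge0 s n : 0 <= (s < n)%R%:R / survival Q s :> R.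
Proof. by rewrite divr_ge0// survival_ge0. Qed.

Let integral_weight s (k : R) : 0 <= k ->
  (\int[Q]_n ((s < n)%R%:R * k)%:E = (survival Q s * k)%:E)%E.
Proof.
move=> k0.
under eq_integral do rewrite EFinM.
rewrite ge0_integralZr//; last first.
- apply/measurable_EFinP.
  exact: measurable_gt_natr.
rewrite EFinM survivalK; congr (_ * _)%E.
rewrite -[in RHS](setIT [set n | s < n]) -integral_indic//; last exact: measurable_gt.
by apply: eq_integral => n _; rewrite indicE mem_setE.
Qed.

(** By independence the weight at time [s] contributes [S(s) / S(s) = 1]. The result is free of [Q],
    so all admissible laws give the same mean. *)
Lemma integral_estimator :
  (\int[P \x Q]_w Z w = \int[leb]_s \int[P]_w (h s w)%:E)%E.
Proof.
transitivity (\int[leb]_s \int[P \x Q]_w (randomized w s)%:E)%E.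
  exact: (@fubini_tonelli _ _ _ _ _ PQ leb
    (fun p => (randomized p.1 p.2)%:E) mEr Er_ge0).
apply: eq_integral => s _.
rewrite (@ge0_integral_product _ _ _ _ _ P Q (h s)
   (fun n : R => (s < n)%R%:R / survival Q s))//.
rewrite integral_weight ?invr_ge0 ?survival_ge0//.
have [s0|s0] := leP 0 s; first by rewrite divff ?mule1// gt_eqF// S_gt0.
by rewrite integral0_eq ?mul0e// => w _; rewrite h_lt0.
Qed.

Definition cross_moment (p : R * R) : \bar R :=
  (\int[P \x Q]_w (randomized w p.1 * randomized w p.2)%:E)%E.

(** For [s <= t] the two indicators multiply to that of [N > t], whose expectation [S(t)] cancels
    one of the two denominators. *)
Lemma cross_momentE s t : 0 <= s -> s <= t ->
  (cross_moment (s, t) =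
   (\int[P]_w (h s w * h t w)%:E) * ((survival Q s)^-1)%:E)%E.
Proof.
move=> s0 st; rewrite /cross_moment /=.
transitivity (\int[P \x Q]_w ((h s w.1 * h t w.1) *
    ((t < w.2)%R%:R * ((survival Q s)^-1 * (survival Q t)^-1)))%:E)%E.
  apply: eq_integral => w _; rewrite /randomized; congr EFin.
  have [tw|tw] := ltP t w.2; last by rewrite !(mul0r, mulr0).
  by rewrite (le_lt_trans st tw) !mul1r mulrACA.
have t0 : 0 <= t := le_trans s0 st.
rewrite (@ge0_integral_product _ _ _ _ _ P Q (fun w => h s w * h t w)
   (fun n : R => (t < n)%R%:R * ((survival Q s)^-1 * (survival Q t)^-1)))//.
- rewrite integral_weight ?mulr_ge0 ?invr_ge0 ?survival_ge0//.
  by congr (_ * _%:E)%E; field; rewrite !gt_eqF ?S_gt0.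
- exact: measurable_funM.
- by apply: measurable_funM => //; exact: measurable_gt_natr.
- by move=> w; rewrite mulr_ge0.
- by move=> n; rewrite !mulr_ge0// invr_ge0 survival_ge0.
Qed.

(** The square is a double time integral; Tonelli moves the expectation inside, and symmetry reduces
    to [s <= t], where the cross moment is explicit. *)
Lemma integral_estimator_sqr :
  (\int[P \x Q]_w (Z w ^+ 2) =
   2%:E * \int[leb]_(s in `[0%R, +oo[) \int[leb]_(t in `[s, +oo[)
     ((\int[P]_w (h s w * h t w)%:E) * ((survival Q s)^-1)%:E))%E.
Proof.
pose K (q : ((T * R) * R) * R) : \bar R :=
  (randomized q.1.1 q.1.2 * randomized q.1.1 q.2)%:E.
have m1 : measurable_fun setT (fun q : ((T * R) * R) * R => q.1) by exact: measurable_fst.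
have m2 : measurable_fun setT (fun q : ((T * R) * R) * R => q.2) by exact: measurable_snd.
have m11 : measurable_fun setT (fun q : ((T * R) * R) * R => q.1.1).
  exact: measurableT_comp measurable_fst m1.
have mK : measurable_fun setT K.
  apply/measurable_EFinP; apply: measurable_funM.
    exact: (measurableT_comp measurable_randomized m1).
  exact: (measurableT_comp measurable_randomized (measurable_fun_pair m11 m2)).
have K0 q : (0 <= K q)%E by rewrite lee_fin mulr_ge0 ?randomized_ge0.
have mrs w : measurable_fun setT (randomized w).
  exact: (measurableT_comp measurable_randomized (pair1_measurable w)).
have mrw s : measurable_fun setT (fun w => randomized w s).
  exact: (measurableT_comp measurable_randomized (pair2_measurable s)).
transitivity (\int[P \x Q]_w \int[leb]_s \int[leb]_t K (w, s, t))%E.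
  apply: eq_integral => w _; rewrite expe2.
  have Erw_ge0 s : (0 <= (randomized w s)%:E)%E by rewrite lee_fin randomized_ge0.
  have mErw : measurable_fun setT (EFin \o randomized w) by apply/measurable_EFinP.
  rewrite -ge0_integralZl//; last by apply: integral_ge0 => s _.
  apply: eq_integral => s _; rewrite -ge0_integralZr//.
  by apply: eq_integral => t _; rewrite /K /= -EFinM mulrC.
(* The expectation passes one time variable at a time: first [s], then [t] with [s] fixed. *)
transitivity (\int[leb]_s \int[P \x Q]_w \int[leb]_t K (w, s, t))%E.
  apply: (@fubini_tonelli _ _ _ _ _ PQ leb
    (fun p => \int[leb]_t K (p, t)))%E.
    exact: (@measurable_fun_fubini_tonelli_F _ _ _ _ _ leb K mK K0).
  by move=> p; exact: integral_ge0.
transitivity (\int[leb]_s \int[leb]_t cross_moment (s, t))%E.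
  apply: eq_integral => s _.
  apply: (@fubini_tonelli _ _ _ _ _ PQ leb (fun p => K (p.1, s, p.2))) => //.
  apply/measurable_EFinP; apply: measurable_funM.
    exact: (measurableT_comp (mrw s) measurable_fst).
  exact: measurable_randomized.
rewrite integral_symmetric; last 3 first.
- pose L (q : (R * R) * (T * R)) : \bar R :=
    (randomized q.2 q.1.1 * randomized q.2 q.1.2)%:E.
  have n1 : measurable_fun setT (fun q : (R * R) * (T * R) => q.1) by exact: measurable_fst.
  have n2 : measurable_fun setT (fun q : (R * R) * (T * R) => q.2) by exact: measurable_snd.
  apply: (@measurable_fun_fubini_tonelli_F _ _ _ _ _ PQ L) => [|q].
    apply/measurable_EFinP; apply: measurable_funM.
      apply: (measurableT_comp measurable_randomized (measurable_fun_pair n2 _)).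
      exact: measurableT_comp measurable_fst n1.
    apply: (measurableT_comp measurable_randomized (measurable_fun_pair n2 _)).
    exact: measurableT_comp measurable_snd n1.
  by rewrite lee_fin mulr_ge0 ?randomized_ge0.
- by move=> p; apply: integral_ge0 => w _; rewrite lee_fin mulr_ge0 ?randomized_ge0.
- by move=> s t; apply: eq_integral => w _; rewrite mulrC.
congr (_ * _)%E; rewrite [RHS]integral_mkcond; apply: eq_integral => s _.
rewrite patchE mem_setE in_itv/= andbT; have [s0|s0] := leP 0 s.
  apply: eq_integral => t; rewrite inE/= in_itv/= andbT => st.
  exact: cross_momentE.
apply: integral0_eq => t _; apply: integral0_eq => w _.
by rewrite /randomized h_lt0// !mul0r.
Qed.

End estimator_moments.

(** * The candidate optimal laws *)

Section exponential_law.
Context (R : realType) (r : R).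
Hypothesis r_gt0 : 0 < r.

Lemma exponential_prob_tail (x : R) : 0 <= x ->
  exponential_prob r [set n : R | x < n] = (expR (- r * x))%:E.
Proof.
move=> x0; rewrite /exponential_prob -set_itvoy integral_itv_obnd_cbnd; last first.
  by apply: measurable_funTS; apply/measurable_EFinP; exact: measurable_exponential_pdf.
transitivity (\int[lebesgue_measure]_(t in `[x, +oo[)
    ((r * expR (- r * x))%:E * (expR (- r * (t - x)))%:E))%E.
  apply: eq_integral => t; rewrite inE/= in_itv/= andbT => xt.
  rewrite exponential_pdfE ?(le_trans x0)// -EFinM -mulrA -expRD.
  by congr (_ * expR _)%:E; ring.
have mexp : measurable_fun `[x, +oo[ (fun t : R => (expR (- r * (t - x)))%:E).
  apply: measurable_funTS; apply/measurable_EFinP; apply: measurableT_comp => //.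
  by apply: measurable_funM => //; exact: measurable_funB.
rewrite ge0_integralZl//; last by rewrite lee_fin mulr_ge0 ?expR_ge0// ltW.
rewrite integral_expR_tail// -EFinM; congr EFin.
by field; rewrite gt_eqF.
Qed.

(** The witness is the law of [max(0, E + s0)] with [E] exponential of rate [r]: a negative [s0]
    puts an atom at 0, a positive one delays the decay until [s0]. *)
Lemma shifted_exponential_law_exists (s0 : R) :
  exists Q : probability R R,
    [/\ Q [set n | 0 <= n] = 1%E,
        forall s, s < 0 -> Q [set n | s < n] = 1%E,
        forall s, 0 <= s -> s <= s0 -> Q [set n | s < n] = 1%E
      & forall s, 0 <= s -> s0 <= s ->
          Q [set n | s < n] = (expR (- r * (s - s0)))%:E].
Proof.
have mX : measurable_fun setT (fun x : measurableTypeR R => Num.max 0 (x + s0)).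
  by apply: measurable_maxr => //; exact: measurable_funD.
have E : {E : probability (measurableTypeR R) R |
    E = exponential_prob r :> (set R -> \bar R)}.
  by unshelve eexists (exponential_prob r : probability (measurableTypeR R) R).
case: E => E EE.
pose X : {RV E >-> R} := HB.pack (fun x : measurableTypeR R => Num.max 0 (x + s0))
  (isMeasurableFun.Build _ _ _ _ _ mX).
have Etail s : 0 <= s -> s0 <= s ->
    E (X @^-1` [set n | s < n]) = (expR (- r * (s - s0)))%:E.
  move=> s_ge0 s0s; rewrite EE -exponential_prob_tail ?subr_ge0//.
  congr (exponential_prob r _); apply/seteqP; split => x /=.
    by rewrite lt_max ltNge s_ge0/= -ltrBlDr.
  by rewrite lt_max ltrBlDr => ->; rewrite orbT.
have E1 (A : set R) : (forall n, 0 <= n -> A n) -> E (X @^-1` A) = 1%E.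
  move=> A1; rewrite -(probability_setT E); congr (E _).
  by apply/seteqP; split => // x _; apply: A1; rewrite /= le_max lexx.
exists (distribution E X); split.
- exact: E1.
- by move=> s s_lt0; apply: E1 => n; exact: lt_le_trans.
- move=> s s_ge0 ss0; apply/eqP; rewrite eq_le probability_le1/=; last exact: measurable_gt.
  (* For [s <= s0] the event contains [E > 0], which already has full mass. *)
  have -> : 1%E = E [set x | 0 < x].
    by rewrite EE exponential_prob_tail// mulr0 expR0.
  apply: le_measure.
  + by rewrite inE; exact: measurable_gt.
  + by rewrite inE; apply: measurable_funPTI; exact: measurable_gt.
  + by move=> x /= x0; rewrite lt_max; apply/orP; right; lra.
- exact: Etail.
Qed.

End exponential_law.

(** * Variance of nonnegative extended-real variables *)

Section evariance_theory.
Local Open Scope ereal_scope.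
Context d (T : measurableType d) (R : realType) (P : probability T R).

(** The second moment, the mean and the variance are all integrals of nonnegative functions, so the
    null-set principle applies to each without measurability. *)
Lemma eq_evariance_off_null (N : set T) (Z1 Z2 : T -> \bar R) :
  measurable N -> P N = 0 -> (forall w, 0 <= Z1 w) -> (forall w, 0 <= Z2 w) ->
  (forall w, ~ N w -> Z1 w = Z2 w) -> evariance P Z1 = evariance P Z2.
Proof.
move=> mN N0 Z10 Z20 Z12; rewrite /evariance.
have -> : \int[P]_w (Z1 w ^+ 2) = \int[P]_w (Z2 w ^+ 2).
  apply: (eq_integral_off_null mN N0) => [w|w|w /Z12->//];
    by rewrite expe2 mule_ge0.
congr (if _ then _ else _); rewrite /variance unlock.
have EZ : 'E_P[fun w => fine (Z1 w)] = 'E_P[fun w => fine (Z2 w)].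
  rewrite unlock; apply: (eq_integral_off_null mN N0) => [w|w|w /Z12->//];
    by rewrite lee_fin fine_ge0.
rewrite EZ unlock; apply: (eq_integral_off_null mN N0) => [w|w|w /Z12 h];
  rewrite ?lee_fin.
- exact: sqr_ge0.
- exact: sqr_ge0.
- by rewrite !fctE /= h.
Qed.

Lemma Lfun2P (f : T -> R) : measurable_fun setT f ->
  \int[P]_w (f w ^+ 2)%:E < +oo -> f \in Lfun P 2%:E.
Proof.
move=> mf f2; rewrite inE; apply/andP; split; rewrite inE//=.
rewrite /finite_norm; apply: (@lty_poweRy _ _ 2%R) => //.
rewrite powR_Lnorm//.
apply: le_lt_trans f2.
by under eq_integral do rewrite /= powR_mulrn// real_normK ?num_real//.
Qed.

(** A finite second moment makes [Z] almost surely finite, so [fine] alters none of the integrals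
    and the usual variance formula applies. *)
Lemma evarianceE (Z : T -> \bar R) :
  measurable_fun setT Z -> (forall w, 0 <= Z w) ->
  \int[P]_w (Z w ^+ 2) < +oo ->
  evariance P Z = \int[P]_w (Z w ^+ 2) - (\int[P]_w Z w) ^+ 2.
Proof.
move=> mZ Z0 Z2; rewrite /evariance Z2.
have mZ2 : measurable_fun setT (fun w => Z w ^+ 2).
  by under eq_fun do rewrite expe2; exact: emeasurable_funM.
have mf : measurable_fun setT (fun w => fine (Z w)).
  exact: measurableT_comp (fine_measurable measurableT) mZ.
have iZ2 : P.-integrable setT (fun w => Z w ^+ 2).
  apply/integrableP; split => //.
  by under eq_integral do rewrite gee0_abs ?expe2 ?mule_ge0// -expe2.
have Zfin : {ae P, forall w, Z w \is a fin_num}.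
  have := integrable_ae measurableT iZ2.
  apply: filterS => w /(_ Logic.I).
  by have := Z0 w; case: (Z w).
have EZ2 : \int[P]_w (fine (Z w) ^+ 2)%:E = \int[P]_w (Z w ^+ 2).
  apply: ae_eq_integral => //.
  - by apply/measurable_EFinP; exact: measurable_funX.
  - apply: filterS Zfin => w Zw _.
    by rewrite expr2 EFinM fineK// expe2.
have EZ : \int[P]_w (fine (Z w))%:E = \int[P]_w Z w.
  apply: ae_eq_integral => //.
  - exact/measurable_EFinP.
  - by apply: filterS Zfin => w Zw _; rewrite fineK.
rewrite varianceE; last by apply: Lfun2P => //; rewrite EZ2.
by rewrite unlock EZ -EZ2.
Qed.

End evariance_theory.

(** With equal means, variances are ordered as second moments. Two measures occur because changing
    the law of [N] changes the product measure. *)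
Lemma le_evariance d (T : measurableType d) (R : realType)
    (P P' : probability T R) (Z Z' : T -> \bar R) :
  measurable_fun setT Z -> measurable_fun setT Z' ->
  (forall w, 0 <= Z w)%E -> (forall w, 0 <= Z' w)%E ->
  (\int[P]_w Z w = \int[P']_w Z' w)%E ->
  (\int[P]_w (Z w ^+ 2) <= \int[P']_w (Z' w ^+ 2))%E ->
  (evariance P Z <= evariance P' Z')%E.
Proof.
move=> mZ mZ' Z0 Z'0 EZ EZ2.
have [fin|inf] := boolP (\int[P']_w (Z' w ^+ 2) < +oo)%E; last first.
  by rewrite {2}/evariance (negbTE inf) leey.
rewrite !evarianceE//; last exact: le_lt_trans fin.
by rewrite EZ leeD2r.
Qed.

(** * Constrained minimization over survival functions *)

Section optimal_survival.
Context (R : realType).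
Local Notation leb := (@lebesgue_measure R).

(** This is the layer-cake formula, applied to the positive part of [n], which equals [n] almost
    surely. *)
Lemma mean_survival (Q : probability R R) : Q [set n | 0 <= n] = 1%E ->
  (mean Q = \int[leb]_(s in `[0%R, +oo[) (survival Q s)%:E)%E.
Proof.
move=> Q1.
have mX : measurable_fun setT (fun n : R => Num.max 0 n).
  by apply: measurable_maxr.
pose X : {RV Q >-> R} := HB.pack (fun n : R => Num.max 0 n)
  (isMeasurableFun.Build _ _ _ _ _ mX).
have mge0 : measurable [set n : R | 0 <= n] by rewrite -set_itvcy.
transitivity ('E_Q[X])%E.
  rewrite /mean unlock; apply: ae_eq_integral => //.
  - by apply/measurable_EFinP.
  exists (~` [set n | 0 <= n]); split; first exact: measurableC.
    by apply: (etrans (probability_setC Q mge0)); rewrite Q1 subee.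
  move=> n /= h n0; apply: h => _.
  by congr EFin; rewrite /= max_r.
rewrite ge0_expectation_ccdf => [|n]; last by rewrite le_max lexx.
apply: eq_integral => s; rewrite inE/= in_itv/= andbT => s0.
rewrite survivalK /ccdf set_itvoy; congr (Q _).
apply/seteqP; split => n /=; first by rewrite lt_max ltNge s0.
by rewrite lt_max => ->; rewrite orbT.
Qed.

Variables (a s0 : R) (Qs : probability R R).
Hypothesis a_gt0 : 0 < a.
Hypothesis Qs_le : forall s, 0 <= s -> s <= s0 -> survival Qs s = 1.
Hypothesis Qs_ge : forall s, 0 <= s -> s0 <= s ->
  survival Qs s = expR (- (a / 2) * (s - s0)).

(** With [A = exp(-a s)] and [k = exp(-a s0)], the convex map [S -> A / S + k S] has its minimum at
    [sqrt(A / k) = exp(-(a/2) (s - s0))]. This exceeds 1 exactly for [s < s0], where the bound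
    [S <= 1] binds. *)
Lemma lagrangian_le (S s : R) : 0 <= s -> 0 < S -> S <= 1 ->
  expR (- a * s) / survival Qs s + expR (- a * s0) * survival Qs s <=
  expR (- a * s) / S + expR (- a * s0) * S.
Proof.
move=> s_ge0 S_gt0 S_le1; have [ss0|s0s] := leP s s0.
  rewrite Qs_le// divr1 mulr1.
  have E : expR (- a * s0) <= expR (- a * s) by rewrite ler_expR !mulNr lerN2 ler_pM2l.
  have k0 := expR_gt0 (- a * s0).
  rewrite -subr_ge0.
  (* Both factors are nonnegative, as [k <= A] and [S <= 1]. *)
  rewrite (_ : _ - _ = (1 - S) * (expR (- a * s) / S - expR (- a * s0))).
    rewrite mulr_ge0 ?subr_ge0// ler_pdivlMr//.
    nra.
  by field; rewrite gt_eqF.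
rewrite (Qs_ge s_ge0 (ltW s0s)).
set x := expR (- (a / 2) * _).
have x_gt0 : 0 < x by exact: expR_gt0.
(* Here [A = k x^2] with [x] the optimal value, so the gap becomes [k / S] times a perfect
   square. *)
have -> : expR (- a * s) = expR (- a * s0) * (x * x).
  by rewrite -!expRD; congr expR; field.
have k0 := expR_gt0 (- a * s0); set k := expR (- a * s0) in k0 *.
rewrite -subr_ge0 (_ : _ - _ = k / S * (x - S) ^+ 2).
  by rewrite mulr_ge0 ?sqr_ge0// divr_ge0// ltW.
by field; rewrite !gt_eqF.
Qed.

Lemma measurable_expR_div_survival (Q : probability R R) :
  measurable_fun setT (fun s => (expR (- a * s) / survival Q s)%:E).
Proof.
apply/measurable_EFinP; apply: measurable_funM.
  by apply: measurableT_comp => //; exact: measurable_funM.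
rewrite (_ : (fun s => (survival Q s)^-1) = (fun s => survival Q s `^ (-1))).
  exact: measurableT_comp (measurable_powR _) (measurable_survival Q).
by apply/funext => p; rewrite powR_inv1// survival_ge0.
Qed.

(** The pointwise Lagrangian inequality is integrated; the multiplier term is the same for [Q] and
    [Qs] and finite, so it cancels even if the remaining integrals are infinite. *)
Lemma optimal_survival (Q : probability R R) :
  (forall s, 0 <= s -> 0 < survival Q s) ->
  (\int[leb]_(s in `[0%R, +oo[) (survival Q s)%:E < +oo)%E ->
  (\int[leb]_(s in `[0%R, +oo[) (survival Qs s)%:E =
   \int[leb]_(s in `[0%R, +oo[) (survival Q s)%:E)%E ->
  (\int[leb]_(s in `[0%R, +oo[) (expR (- a * s) / survival Qs s)%:E <=
   \int[leb]_(s in `[0%R, +oo[) (expR (- a * s) / survival Q s)%:E)%E.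
Proof.
move=> Q_gt0 fin eqm.
pose k := expR (- a * s0); have k0 : 0 <= k := expR_ge0 _.
have mS (Q' : probability R R) :
    measurable_fun setT (fun s => (survival Q' s)%:E).
  by apply/measurable_EFinP; exact: measurable_survival.
have key (Q' : probability R R) :
    (\int[leb]_(s in `[0%R, +oo[)
      (expR (- a * s) / survival Q' s + k * survival Q' s)%:E =
    \int[leb]_(s in `[0%R, +oo[) (expR (- a * s) / survival Q' s)%:E +
    k%:E * \int[leb]_(s in `[0%R, +oo[) (survival Q' s)%:E)%E.
  have S_ge0 s : (0 <= (survival Q' s)%:E)%E by rewrite lee_fin survival_ge0.
  have mSD : measurable_fun (`[0, +oo[%classic : set R) (fun s => (survival Q' s)%:E).
    exact: measurable_funTS.
  rewrite -ge0_integralZl// -ge0_integralD//.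
  - by move=> s _; rewrite lee_fin divr_ge0 ?expR_ge0 ?survival_ge0.
  - by apply: measurable_funTS; exact: measurable_expR_div_survival.
  - by move=> s _; rewrite mule_ge0.
  - exact: emeasurable_funM.
have kfin : (k%:E * \int[leb]_(s in `[0%R, +oo[) (survival Q s)%:E)%E \is a fin_num.
  rewrite fin_numM// ge0_fin_numE//.
  by apply: integral_ge0 => s _; rewrite lee_fin survival_ge0.
rewrite -(leeD2rE _ _ kfin) -{1}eqm -!key.
have mF (Q' : probability R R) : measurable_fun (`[0, +oo[%classic : set R)
    (fun s => (expR (- a * s) / survival Q' s + k * survival Q' s)%:E).
  apply: measurable_funTS; apply/measurable_EFinP; apply: measurable_funD.
    by apply/measurable_EFinP; exact: measurable_expR_div_survival.
  by apply: measurable_funM => //; exact: measurable_survival.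
apply: ge0_le_integral => //.
- move=> s _.
  by rewrite lee_fin addr_ge0 ?mulr_ge0 ?invr_ge0 ?expR_ge0 ?survival_ge0.
- exact: mF.
- exact: mF.
move=> s; rewrite /= in_itv/= andbT => s_ge0.
by rewrite lee_fin lagrangian_le ?Q_gt0 ?survival_le1.
Qed.

Lemma integral_survival_le0 : s0 <= 0 ->
  (\int[leb]_(s in `[0%R, +oo[) (survival Qs s)%:E =
   (2 / a * expR (a / 2 * s0))%:E)%E.
Proof.
move=> s0_le0.
transitivity (\int[leb]_(s in `[0%R, +oo[)
   ((expR (a / 2 * s0))%:E * (expR (- (a / 2) * (s - 0)))%:E))%E.
  apply: eq_integral => s; rewrite inE/= in_itv/= andbT => s_ge0.
  rewrite Qs_ge ?(le_trans s0_le0)// -EFinM -expRD.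
  by congr (expR _)%:E; ring.
have mexp : measurable_fun (`[0, +oo[%classic : set R) (fun s : R => (expR (- (a / 2) * (s - 0)))%:E).
  apply: measurable_funTS; apply/measurable_EFinP; apply: measurableT_comp => //.
  by apply: measurable_funM => //; exact: measurable_funB.
rewrite ge0_integralZl//.
rewrite integral_expR_tail ?divr_gt0// -EFinM; congr EFin.
by field; rewrite gt_eqF.
Qed.

Lemma integral_survival_ge0 : 0 <= s0 ->
  (\int[leb]_(s in `[0%R, +oo[) (survival Qs s)%:E = (s0 + 2 / a)%:E)%E.
Proof.
move=> s0_ge0.
rewrite (_ : `[0, +oo[%classic = `[0, s0[%classic `|` (`[s0, +oo[%classic : set R)); last first.
  by rewrite -itv_bndbnd_setU// bnd_simp.
rewrite ge0_integral_setU//; first last.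
- apply/disj_setPLR => s /=; rewrite !in_itv/= andbT => /andP[_ ss0].
  by apply/negP; rewrite -ltNge.
- by move=> s _; rewrite lee_fin survival_ge0.
- apply: measurable_funTS; apply/measurable_EFinP; exact: measurable_survival.
rewrite (eq_integral (cst 1%E)) => [|s]; last first.
  by rewrite inE/= in_itv/= => /andP[? /ltW ?]; rewrite Qs_le.
rewrite integral_cst//= mul1e lebesgue_measure_itv/= lte_fin.
transitivity (s0%:E + (2 / a)%:E)%E => //; congr (_ + _)%E.
  (* The length of the interval is given as 0 unless [0 < s0]; as [0 <= s0], the other case is
     [s0 = 0]. *)
  by case: ltP => [_|s0_le0]; [rewrite oppr0 adde0|congr EFin; lra].
transitivity (\int[leb]_(s in `[s0, +oo[) (expR (- (a / 2) * (s - s0)))%:E)%E.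
  apply: eq_integral => s; rewrite inE/= in_itv/= andbT => s0s.
  by rewrite Qs_ge// (le_trans s0_ge0).
rewrite integral_expR_tail ?divr_gt0//; congr EFin.
by rewrite invf_div.
Qed.

End optimal_survival.

(** * The Lévy estimator and its minimal variance *)

Section levy_estimator.
Context d (T : measurableType d) (R : realType) (P : probability T R).
Variables (Y : R -> {RV P >-> R}) (phi : R -> R) (b c : R).
Local Notation leb := (@lebesgue_measure R).
Hypothesis hY : levy_process Y.
Hypothesis hphi1 : has_exponent_at Y phi b.
Hypothesis hphi2 : has_exponent_at Y phi (2 * b).

Let g (x t : R) : R := expR (- c * t) * x `^ b.
Let X := exp_process Y.

(** Tonelli needs joint measurability, which right continuity of every path provides; hence the
    exceptional paths are replaced on a null set. *)
Lemma discounted_process_version : exists (N : set T) (h : R -> T -> R),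
  [/\ measurable N /\ P N = 0%E,
      measurable_fun setT (fun p : R * T => h p.1 p.2),
      forall s w, 0 <= h s w,
      forall s w, s < 0 -> h s w = 0
    & forall s w, 0 <= s -> ~ N w -> h s w = g (X s w) s].
Proof.
have [_ [N [mN N0 hN]] _ _] := hY.
(* Paths are set to 0 on [N] and at negative times. The possible jump at time 0 is harmless, since
   only right continuity is required. *)
pose u t w := if 0 <= t then ((Y t : T -> R) \_ (~` N)) w else 0.
pose h s w := if 0 <= s then expR (- c * s) * expR (u s w * b) else 0.
have mu t : measurable_fun setT (u t).
  rewrite /u; have [_|_] := leP 0 t; last exact: measurable_cst.
  have mNC : measurable (~` N) by exact: measurableC.
  by apply/(measurable_restrictT _ mNC)/measurable_funTS.
have rcu w : right_continuous (u ^~ w).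
  have [Nw|nNw] := pselect (N w).
    have u0 t : u t w = 0 by rewrite /u patchE memNset ?if_same.
    have -> : u ^~ w = cst 0 by apply/funext.
    by move=> t; rewrite u0; exact: cvg_cst.
  have [rc _] : cadlag (fun t => Y t w) by apply: contrapT => hc; exact/nNw/hN.
  have uE t : 0 <= t -> u t w = Y t w by rewrite /u => ->; rewrite patchE mem_set.
  move=> t; have [t0|t0] := leP 0 t.
    rewrite uE//; apply: cvg_trans (rc _ t0).
    apply: near_eq_cvg; near=> s; rewrite uE// (le_trans t0)// ltW//.
  have -> : u t w = 0 by rewrite /u leNgt t0.
  apply: cvg_near_cst; near=> s; rewrite /u leNgt.
  by have -> : s < 0 by near: s; exact: nbhs_right_lt.
exists N, h; split => //.
- apply: measurable_fun_ifT => //.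
    by apply: measurable_fun_ler => //; exact: measurable_fst.
  apply: measurable_funM; apply: measurableT_comp => //; apply: measurable_funM => //.
  exact: measurable_right_continuous_process.
- by move=> s w; rewrite /h; case: ifP => // _; rewrite mulr_ge0 ?expR_ge0.
- by move=> s w s0; rewrite /h leNgt s0.
- move=> s w s0 nNw; rewrite /h s0 /g /X /exp_process expRM /u s0 patchE mem_set//.
Unshelve. all: by end_near. Qed.

(** The set where version and process disagree lies over [N], and [N] times the line is null for
    [P \x Q] whatever [Q] is; one version serves all laws. *)
Lemma estimator_variance_version (Q : probability R R) (N : set T) (h : R -> T -> R) :
  measurable N -> P N = 0%E -> (forall s w, 0 <= h s w) ->
  (forall s w, s < 0 -> h s w = 0) ->
  (forall s w, 0 <= s -> ~ N w -> h s w = g (X s w) s) ->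
  estimator_variance P X g Q =
  evariance (P \x Q)%E (fun w => \int[leb]_s (randomized Q h w s)%:E)%E.
Proof.
move=> mN N0 h0 h_lt0 hE.
apply: (@eq_evariance_off_null _ _ _ _ (N `*` setT)).
- exact: measurableX.
- transitivity (P N * Q setT)%E; last by rewrite N0 mul0e.
  exact: product_measure1E.
- move=> w; apply: integral_ge0 => s _; rewrite lee_fin.
  rewrite mulr_ge0 ?divr_ge0 ?survival_ge0//.
  by rewrite mulr_ge0 ?expR_ge0 ?powR_ge0.
- by move=> w; apply: integral_ge0 => s _; rewrite lee_fin randomized_ge0.
move=> w nNw; rewrite /estimator integral_mkcond; apply: eq_integral => s _.
rewrite patchE mem_setE in_itv/= andbT /randomized; have [s0|s0] := leP 0 s.
  by rewrite hE// => Nw; apply: nNw.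
by rewrite h_lt0// mul0r.
Qed.

Hypothesis phi1_lt : phi b < c.
Hypothesis phi2_lt : phi (2 * b) < 2 * c.
Let a := 2 * c - phi (2 * b).
Let theta := c - phi b.

Let a_gt0 : 0 < a. Proof. by rewrite subr_gt0. Qed.
Let theta_gt0 : 0 < theta. Proof. by rewrite subr_gt0. Qed.

(** The inner integral over [t >= s] decays at rate [theta] and gives [1 / theta]; the factor 2
    comes from the symmetry in [s] and [t]. *)
Lemma integral_estimator_sqr_levy (Q : probability R R) (N : set T) (h : R -> T -> R) :
  measurable N -> P N = 0%E ->
  measurable_fun setT (fun p : R * T => h p.1 p.2) ->
  (forall s w, 0 <= h s w) -> (forall s w, s < 0 -> h s w = 0) ->
  (forall s w, 0 <= s -> ~ N w -> h s w = g (X s w) s) ->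
  (forall s, 0 <= s -> 0 < survival Q s) ->
  (\int[P \x Q]_w ((\int[leb]_s (randomized Q h w s)%:E) ^+ 2) =
   (2 / theta)%:E *
   \int[leb]_(s in `[0%R, +oo[) (expR (- a * s) / survival Q s)%:E)%E.
Proof.
move=> mN N0 mh h0 h_lt0 hE Q_gt0.
have M s t : 0 <= s -> s <= t -> (\int[P]_w (h s w * h t w)%:E =
    (expR (- a * s) * expR (- theta * (t - s)))%:E)%E.
  move=> s0 st; have t0 := le_trans s0 st.
  (* Writing [s + t = 2 s + (t - s)] shares the discount between the exponents [phi (2 * b)] and
     [phi b], which become [-a] and [-theta]. *)
  transitivity (\int[P]_w ((expR (- c * (s + t)))%:E *
      (expR (b * Y s w) * expR (b * Y t w))%:E))%E.
    apply: (eq_integral_off_null mN N0) => w.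
    - by rewrite lee_fin mulr_ge0.
    - by rewrite lee_fin !mulr_ge0 ?expR_ge0.
    move=> nNw; rewrite !hE// /g /X /exp_process -!expRM -EFinM -!expRD.
    by congr (expR _)%:E; ring.
  have mYY : measurable_fun setT (fun w => (expR (b * Y s w) * expR (b * Y t w))%:E).
    by apply/measurable_EFinP; apply: measurable_funM; apply: measurableT_comp => //;
      exact: measurable_funM.
  rewrite ge0_integralZl//.
  rewrite (levy_exp_moment2 hY hphi1 hphi2)// -EFinM -!expRD.
  by congr (expR _)%:E; rewrite /a /theta; ring.
rewrite integral_estimator_sqr// EFinM -muleA; congr (_ * _)%E.
rewrite -ge0_integralZl//; last 3 first.
- by apply: measurable_funTS; exact: measurable_expR_div_survival.
- by move=> s _; rewrite lee_fin divr_ge0 ?expR_ge0 ?survival_ge0.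
- by rewrite lee_fin invr_ge0 ltW.
apply: eq_integral => s; rewrite inE/= in_itv/= andbT => s0.
transitivity (\int[leb]_(t in `[s, +oo[)
   ((expR (- a * s) / survival Q s)%:E * (expR (- theta * (t - s)))%:E))%E.
  apply: eq_integral => t; rewrite inE/= in_itv/= andbT => st.
  by rewrite M// -!EFinM; congr EFin; ring.
have mexp : measurable_fun (`[s, +oo[%classic : set R)
    (fun t => (expR (- theta * (t - s)))%:E).
  apply: measurable_funTS; apply/measurable_EFinP; apply: measurableT_comp => //.
  by apply: measurable_funM => //; exact: measurable_funB.
rewrite ge0_integralZl//; last by rewrite lee_fin divr_ge0 ?expR_ge0 ?survival_ge0.
by rewrite integral_expR_tail// muleC.
Qed.

(** Against any competitor the means agree, so variances compare as second moments, that is, up to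
    the positive factor [2 / theta], as integrals of [exp(-a s) / S(s)]. *)
Lemma levy_infimum_attained (m s0 : R) (Qs : probability R R) :
  Qs [set n | 0 <= n] = 1%E ->
  (forall s, 0 <= s -> s <= s0 -> survival Qs s = 1) ->
  (forall s, 0 <= s -> s0 <= s ->
    survival Qs s = expR (- (a / 2) * (s - s0))) ->
  (\int[leb]_(s in `[0%R, +oo[) (survival Qs s)%:E = m%:E)%E ->
  infimum_attained_at P X g m Qs.
Proof.
move=> Qs0 Qs_le Qs_ge Qsm.
have Qs_gt0 s : 0 <= s -> 0 < survival Qs s.
  move=> s_ge0; have [ss0|/ltW s0s] := leP s s0; first by rewrite Qs_le.
  by rewrite Qs_ge// expR_gt0.
have admQs : admissible m Qs by split; [split|rewrite mean_survival].
split=> //; apply/eqP; rewrite eq_le; apply/andP; split.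
  by apply: ereal_inf_lbound; exists Qs.
apply: le_ereal_inf_tmp => _ [Q [[Q0 Q_gt0] Qm] <-].
rewrite mean_survival// in Qm.
have [N [h [[mN N0] mh h0 h_lt0 hE]]] := discounted_process_version.
rewrite !(estimator_variance_version _ mN N0 h0 h_lt0 hE).
apply: le_evariance.
- exact: measurable_integral_randomized.
- exact: measurable_integral_randomized.
- by move=> w; apply: integral_ge0 => s _; rewrite lee_fin randomized_ge0.
- by move=> w; apply: integral_ge0 => s _; rewrite lee_fin randomized_ge0.
- by rewrite !integral_estimator.
rewrite !(integral_estimator_sqr_levy mN N0 mh h0 h_lt0 hE)//.
apply: lee_wpmul2l; first by rewrite lee_fin divr_ge0// ltW.
apply: (optimal_survival a_gt0 Qs_le Qs_ge) => //.
  by rewrite Qm ltry.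
by rewrite Qsm Qm.
Qed.

End levy_estimator.

(** * Fixing the shift by the mean constraint in the two regimes *)

Theorem corollary2 (R : realType) (d : measure_display) (T : measurableType d)
    (P : probability T R) (Y : R -> {RV P >-> R}) (phi : R -> R)
    (beta c m : R) (f : R -> R) (g : R -> R -> R) (phi1 phi2 : R -> R)
    (hY : levy_process Y)
    (hphi1 : has_exponent_at Y phi beta)
    (hphi2 : has_exponent_at Y phi (2 * beta))
    (hc : 0 < c) (hm : 0 < m)
    (hf : f = fun x => x `^ beta)
    (hg : g = fun x t => expR (- c * t) * f x)
    (h1 : phi1 = fun b => phi b - c)
    (h2 : phi2 = fun b => phi b - 2 * c)
    (hneg1 : phi1 beta < 0) (hneg2 : phi2 (2 * beta) < 0) :
  let a := `|phi2 (2 * beta)| in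
  (m * a <= 2 ->
     exists Qstar : probability R R,
       (forall s, 0 < s -> Qstar [set n : R | s < n] =
          (m / 2 * a * expR (- (s / 2 * a)))%:E) /\
       infimum_attained_at P (exp_process Y) g m Qstar) /\
  (2 < m * a ->
     exists Qstar : probability R R,
       (forall s, Qstar [set n : R | s < n] =
          (if s <= m - 2 / a then 1
           else expR (m / 2 * a - 1 - s / 2 * a))%:E) /\
       infimum_attained_at P (exp_process Y) g m Qstar).
Proof.
subst f g phi1 phi2 => a.
have phi1_lt : phi beta < c by rewrite -subr_lt0.
have phi2_lt : phi (2 * beta) < 2 * c by rewrite -subr_lt0.
have aE : a = 2 * c - phi (2 * beta) by rewrite /a ltr0_norm// opprB.
have a_gt0 : 0 < a by rewrite aE subr_gt0.
have a2_gt0 : 0 < a / 2 by rewrite divr_gt0.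
(* Every shift [s0] yields an optimal law for its own mean; it remains to tune [s0] so that this
   mean is [m]. *)
have law (s0 : R) : exists Q : probability R R,
    [/\ forall s, s < 0 -> Q [set n | s < n] = 1%E,
        forall s, 0 <= s -> s <= s0 -> survival Q s = 1,
        forall s, 0 <= s -> s0 <= s -> survival Q s = expR (- (a / 2) * (s - s0))
      & (\int[lebesgue_measure]_(s in `[0%R, +oo[) (survival Q s)%:E = m%:E)%E ->
        infimum_attained_at P (exp_process Y)
          (fun x t => expR (- c * t) * x `^ beta) m Q].
  have [Q [Q0 Q_lt0 Q_le Q_ge]] := shifted_exponential_law_exists a2_gt0 s0.
  have Q_le' s : 0 <= s -> s <= s0 -> survival Q s = 1.
    by move=> ? ?; rewrite /survival Q_le.
  have Q_ge' s : 0 <= s -> s0 <= s -> survival Q s = expR (- (a / 2) * (s - s0)).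
    by move=> ? ?; rewrite /survival Q_ge.
  exists Q; split => // Qm.
  rewrite aE in Q_ge'.
  exact: (levy_infimum_attained hY hphi1 hphi2 phi1_lt phi2_lt Q0 Q_le' Q_ge' Qm).
split=> [ma2|ma2].
  have ma0 : 0 < m / 2 * a by rewrite mulr_gt0// divr_gt0.
  (* Solves [(2 / a) exp((a / 2) s0) = m]; the logarithm is nonpositive because [m a / 2 <= 1]. *)
  pose s0 := ln (m / 2 * a) / (a / 2).
  have s0_le0 : s0 <= 0.
    by rewrite pmulr_lle0 ?invr_gt0// ln_le0//; lra.
  have Es0 : expR (a / 2 * s0) = m / 2 * a.
    by rewrite /s0 mulrC divfK ?gt_eqF// lnK.
  have [Q [_ Q_le Q_ge Qinf]] := law s0.
  exists Q; split.
    move=> s s_gt0; rewrite -survivalK Q_ge ?(ltW s_gt0)//; last exact/ltW/(le_lt_trans s0_le0).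
    by rewrite -Es0 -expRD; congr (expR _)%:E; ring.
  apply: Qinf; rewrite (integral_survival_le0 a_gt0 Q_ge)// Es0; congr EFin.
  by field; rewrite gt_eqF.
(* Solves [s0 + 2 / a = m], the plateau length plus the mean of the exponential part; [m a > 2]
   makes it nonnegative. *)
pose s0 := m - 2 / a.
have s0_ge0 : 0 <= s0.
  by rewrite subr_ge0 ler_pdivrMr// ltW.
have [Q [Q_lt0 Q_le Q_ge Qinf]] := law s0.
exists Q; split.
  move=> s; have [s_lt0|s_ge0] := ltP s 0.
    (* The formula is claimed for negative [s] as well; they fall in the branch with value 1, since
       [s0] is nonnegative. *)
    by rewrite Q_lt0// ifT// ltW// (lt_le_trans s_lt0).
  rewrite -survivalK; case: ifPn => [ss0|]; first by rewrite Q_le.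
  rewrite -ltNge => /ltW s0s; rewrite Q_ge//.
  by congr (expR _)%:E; rewrite /s0; field; rewrite gt_eqF.
apply: Qinf; rewrite (integral_survival_ge0 a_gt0 Q_le Q_ge)//; congr EFin.
by rewrite subrK.
Qed.
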